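(* Let $G$ be a regular distance magic graph of cube-free order $n$, that is, $p^3\nmid n$ for every prime $p$. Then, for every abelian group $\Gamma$ of order $n$, the graph $G$ admits a generating $\Gamma$-magic map.
   Context: Graphs are finite, simple and undirected; $N_G(v)$ is the open neighborhood of $v$. A graph $G$ of order $n$ is distance magic if there is a bijection $\ell\colon V(G)\to\{1,\dots,n\}$ such that the integer $\sum_{u\in N_G(v)}\ell(u)$ is the same for all $v\in V(G)$. For a finite abelian group $\Gamma$, a map $f\colon V(G)\to\Gamma$ is a $\Gamma$-magic map if there is $\gamma\in\Gamma$ with $\sum_{u\in N_G(v)}f(u)=\gamma$ for every $v\in V(G)$; it is generating if the labels $f(v)$, $v\in V(G)$, generate $\Gamma$. *)

(* Defs.v *)
From HB Require Import structures.
From mathcomp Require Import all_boot all_order all_algebra all_fingroup.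

Set Implicit Arguments.
Unset Strict Implicit.
Unset Printing Implicit Defensive.

Import GRing.Theory.

Record sgraph := SGraph {
  vertex :> finType;
  adj : rel vertex;
  adj_sym : symmetric adj;
  adj_irr : irreflexive adj
}.

Definition nbhd (G : sgraph) (v : G) : {set G} := [set u | adj v u].

Definition regular (G : sgraph) : Prop :=
  exists r : nat, forall v : G, #|nbhd v| = r.

(* A bijection onto {1, ..., n} is encoded as a bijection l onto the ordinals
   {0, ..., n - 1}, the label of u being (l u).+1. *)
Definition distance_magic (G : sgraph) : Prop :=
  exists2 l : G -> 'I_#|G|, bijective l &
  exists k : nat, forall v : G, \sum_(u in nbhd v) (l u).+1 = k.

Definition cube_free (n : nat) : Prop :=
  forall p : nat, prime p -> ~~ (p ^ 3 %| n).

Definition magic_map (G : sgraph) (gT : finZmodType) (f : G -> gT) : Prop :=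
  exists c : gT, forall v : G, (\sum_(u in nbhd v) f u)%R = c.

(* The group operation underlying <<_>> on a finZmodType is its addition. *)
Definition generating (G : sgraph) (gT : finZmodType) (f : G -> gT) : Prop :=
  <<[set f v | v : G]>>%g = [set: gT].

(* Main.v *)
Require Import Defs.
From mathcomp Require Import all_boot all_order all_algebra all_fingroup.
From mathcomp Require Import abelian.

Import GRing.Theory FinRing.Theory.

(** Constant maps are magic because the graph is regular, so for a distance
    magic labelling l and any a, b in an abelian group, u |-> l u * a + b is
    magic. Two vertices with consecutive labels have values differing by a, so
    the values generate <a, b>. An abelian group of cube-free order has rank at
    most 2, since the p-torsion of a group of rank at least 3 contains
    (Z/p)^3 for some prime p; hence it is of the form <a, b>. *)

Lemma cube_free_rank (gT : finGroupType) (H : {group gT}) :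
  cube_free #|H| -> 'r(H)%g <= 2.
Proof.
move=> cfH; have [p p_pr ->] := rank_witness H.
rewrite leqNgt; apply: contra (cfH p p_pr) => /p_rank_geP [E].
rewrite pnElemE // !inE => /andP [/andP [sEH _] /eqP <-].
exact: cardSg.
Qed.

(** In an abelian group the least size of a generating set equals the rank, which is at most 2
    here. *)
Lemma cube_free_abelian_gen2 (gT : finGroupType) (H : {group gT}) :
  abelian H -> cube_free #|H| -> exists a b : gT, <<[set a; b]>>%g = H.
Proof.
move=> abH cfH; have [B genB cardB] := grank_witness H.
have: #|B| <= 2 by rewrite cardB grank_abelian // cube_free_rank.
rewrite leq_eqVlt ltnS => /orP [/cards2P [a [b [_ defB]]] | ].
  by exists a, b; rewrite -defB.
(* A smaller generating set is padded to a pair: a lone generator is repeated, and the empty set is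
   replaced by the identity. *)
rewrite leq_eqVlt ltnS leqn0 cards_eq0 => /orP [/cards1P [a defB] | /eqP defB].
  by exists a, a; rewrite setUid -defB.
by exists 1%g, 1%g; rewrite setUid -genB defB gen0 genGid.
Qed.

Lemma magic_affine (G : sgraph) (gT : finZmodType) (l : G -> nat) (k r : nat)
    (a b : gT) :
    (forall v : G, \sum_(u in nbhd v) l u = k) ->
    (forall v : G, #|nbhd v| = r) ->
  magic_map (fun u => a *+ l u + b)%R.
Proof.
move=> sum_l deg_r; exists (a *+ k + b *+ r)%R => v.
by rewrite big_split /= sumr_const deg_r sumrMnr sum_l.
Qed.

Lemma generating_affine (G : sgraph) (gT : finZmodType) (l : G -> nat)
    (a b : gT) (u v : G) :
    l v = (l u).+1 -> <<[set a; b]>>%g = [set: gT] ->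
  generating (fun w => a *+ l w + b)%R.
Proof.
move=> l_uv gen_ab; apply/eqP; rewrite eqEsubset subsetT -gen_ab gen_subG.
set H := <<_>>%G; have fH w : (a *+ l w + b)%R \in H.
  exact/mem_gen/imset_f.
have aH : a \in H.
  have -> : a = ((a *+ l v + b)%R * ((a *+ l u + b)%R)^-1)%g.
    by rewrite zmodMgE zmodVgE l_uv mulrS -(addrA a) addrK.
  by rewrite groupM ?groupV.
apply/subsetP => x /set2P [] -> //.
(* As [a] lies in [H], so does [b] once the value [a *+ l u + b] at [u] does. *)
by rewrite -(groupMl _ (groupX (l u) aH)) zmodXgE zmodMgE.
Qed.

Theorem corollary4p7 (G : sgraph) (n : nat) (G_order : #|G| = n)
    (G_regular : regular G) (G_magic : distance_magic G)
    (n_cube_free : cube_free n)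
    (gT : finZmodType) (gT_order : #|gT| = n) :
  exists f : G -> gT, magic_map f /\ generating f.
Proof.
have [r deg_r] := G_regular; have [l [l' _ l'K] [k sum_l]] := G_magic.
have cfT : cube_free #|[set: gT]| by rewrite cardsT gT_order.
have [a [b gen_ab]] :=
  cube_free_abelian_gen2 _ [group of [set: gT]] (zmod_abelian _) cfT.
exists (fun u => a *+ (l u).+1 + b)%R.
split; first exact: magic_affine sum_l deg_r.
(* The vertices labelled 1 and 2 serve as the consecutive pair; they exist only for order at least
   2. Otherwise [gT] is trivial and any map generates it. *)
have [n_gt1 | n_le1] := ltnP 1 #|G|.
  apply: (@generating_affine _ _ (fun u => (l u).+1) _ _
    (l' (Ordinal (ltnW n_gt1))) (l' (Ordinal n_gt1))) => //.
  by rewrite !l'K.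
apply/setP => x; rewrite inE.
have -> : x = 1%g; last exact: group1.
by apply: (fintype_le1P _) => //; rewrite gT_order -G_order.
Qed.
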